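(* Let $(W,S)$ be a Coxeter system and $n\mathcal{H}$ the associated nil Hecke algebra. Let $s,t\in S$ be two simple reflections with $m=m_{st}<\infty$, let $W_{s,t}\subseteq W$ be the subgroup generated by $s,t$, with longest element $w_{o,s,t}$, and let $w\in W_{s,t}$ with $w\neq w_{o,s,t}$. Let ${}_s\underline{\hat m}=\underline{sts\cdots}$ and ${}_t\underline{\hat m}=\underline{tst\cdots}$ be the two alternating expressions with $m$ letters. Then the relation $$\sum_{\substack{\iota\colon\underline{w}\hookrightarrow\,{}_s\underline{\hat m}\\ \underline{w}\text{ a reduced expression of }w}}\operatorname{mix}_\iota\;=\;\sum_{\substack{\iota\colon\underline{w}\hookrightarrow\,{}_t\underline{\hat m}\\ \underline{w}\text{ a reduced expression of }w}}\operatorname{mix}_\iota$$ holds in $n\mathcal{H}$, where each sum runs over all embedded subexpressions of the indicated expression which are reduced expressions of $w$.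
   Context: Ground field $k=\mathbb{R}$. All algebras are associative and unital. **Coxeter system and geometric representation.** $(W,S)$ is a Coxeter system: $W=\langle s\in S\mid s^2=1,\ (st)^{m_{st}}=1 \text{ for } s\neq t\rangle$, where $m_{st}=m_{ts}=\operatorname{ord}(st)\ge 2$ may be infinite (then no relation is imposed). Let $\mathfrak{h}^*=\bigoplus_{s\in S}\mathbb{R}\alpha_s$ with symmetric bilinear form $(\alpha_s,\alpha_t)=-\cos(\pi/m_{st})$, where $m_{ss}=1$ and $\pi/\infty=0$. For $\lambda\in\mathfrak{h}^*$ put $\langle\lambda,\alpha_s^\vee\rangle=\frac{2(\lambda,\alpha_s)}{(\alpha_s,\alpha_s)}$. The formula $s(\lambda)=\lambda-\langle\lambda,\alpha_s^\vee\rangle\alpha_s$ defines a faithful representation of $W$ on $\mathfrak{h}^*$, hence an action of $W$ on $R=\operatorname{Sym}(\mathfrak{h}^* )$. **Nil Hecke algebra.** $n\mathcal{H}$ is the $k$-algebra generated by the vector space $\mathfrak{h}^*$ and elements $\partial_s$ ($s\in S$) subject to: $\lambda\mu=\mu\lambda$ for $\lambda,\mu\in\mathfrak{h}^*$; $\partial_s\lambda=s(\lambda)\partial_s+\langle\lambda,\alpha_s^\vee\rangle$; $\partial_s^2=0$; and $\partial_s\partial_t\partial_s\cdots=\partial_t\partial_s\partial_t\cdots$ ($m_{st}$ factors on each side) for $s\ne t$ with $m_{st}<\infty$. It is known that $R$ embeds in $n\mathcal{H}$ and that $s\mapsto 1-\alpha_s\partial_s$ embeds the group $W$ (indeed the twisted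 group algebra $R\star W$) in $n\mathcal{H}$. Via this embedding we write $s=1-\alpha_s\partial_s\in n\mathcal{H}$. **Expressions.** An expression $\underline{w}=\underline{s_1\cdots s_r}$ is a finite sequence of letters of $S$. It is an expression of the element $w=s_1\cdots s_r\in W$, and it is reduced if its length $|\underline{w}|=r$ is minimal among all expressions of $w$. The group $W_{s,t}$ is dihedral of order $2m$, and $w_{o,s,t}$ is its element with the two reduced expressions ${}_s\underline{\hat m}$ and ${}_t\underline{\hat m}$. An embedded subexpression $\iota\colon\underline{y}\hookrightarrow\underline{w}$ is a choice of letters of $\underline{w}$ to leave out, such that the remaining letters form $\underline{y}$. Equivalently, it is a function $\chi_\iota\colon\{1,\dots,|\underline{w}|\}\to\{0,1\}$, with $\chi_\iota(j)=1$ iff the $j$-th letter is kept. Thus $\underline{w}$ has exactly $2^{|\underline{w}|}$ embedded subexpressions, and different embeddings are counted separately. **Mixed monomials.** For an embedded subexpression $\iota\colon\underline{y}\hookrightarrow\underline{s_1\cdots s_r}$, put $\operatorname{mix}_\iota=\operatorname{mix}_{\iota,1}\operatorname{mix}_{\iota,2}\cdots\operatorname{mix}_{\iota,r}\in n\mathcal{H}$, where $\operatorname{mix}_{\iota,j}=s_j$ if $\chi_\iota(j)=1$ and $\operatorname{mix}_{\iota,j}=\partial_{s_j}$ if $\chi_\iota(j)=0$. *)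

(* Defs.v *)
(* MathComp, with MathComp-Analysis for the reals ([realType], [cos], [pi])
   and multinomials for free modules ([{malg R[S]}]). *)
From HB Require Import structures.
From mathcomp Require Import all_boot all_order all_algebra.
From mathcomp Require Import boolp reals trigo.
From mathcomp Require Import finmap monalg.

Set Implicit Arguments.
Unset Strict Implicit.
Unset Printing Implicit Defensive.

Import GRing.Theory.

Local Open Scope ring_scope.
Local Open Scope quotient_scope.

(** * Coxeter systems *)

(* [alt_word s t k] is [:: s; t; s; ...] with [k] letters. *)
Definition alt_word (S : Type) (s t : S) (k : nat) : seq S :=
  mkseq (fun i => if odd i then t else s) k.

(* Equality of words in the group presented by the Coxeter relations.  As
   s^2 = 1, the group is the quotient of the free monoid on [S], so formal
   inverses of letters are not needed. *)
Inductive coxeter_eq (S : choiceType) (m : S -> S -> nat) :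
    seq S -> seq S -> Prop :=
| CoxRefl u : coxeter_eq m u u
| CoxSym u v : coxeter_eq m u v -> coxeter_eq m v u
| CoxTrans u v w : coxeter_eq m u v -> coxeter_eq m v w -> coxeter_eq m u w
| CoxCat u u' v v' : coxeter_eq m u u' -> coxeter_eq m v v' ->
    coxeter_eq m (u ++ v) (u' ++ v')
| CoxSquare s : coxeter_eq m [:: s; s] [::]
| CoxOrder s t : s != t -> (0 < m s t)%N ->
    coxeter_eq m (flatten (nseq (m s t) [:: s; t])) [::].

(* The value [cox_m s t = 0] encodes m_st = infinity; with this convention
   [cox_m_order] says that [cox_m s t] is the order of st also in the infinite
   case, since 0 divides k only for k = 0. *)
Record coxeterSystem (W : groupType) (S : choiceType) := CoxeterSystem {
  cox_gen :> S -> W;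
  cox_m : S -> S -> nat;
  cox_m_diag : forall s, cox_m s s = 1%N;
  cox_m_sym : forall s t, cox_m s t = cox_m t s;
  cox_m_neq1 : forall s t, s != t -> cox_m s t != 1%N;
  cox_m_order : forall s t k,
    ((cox_gen s * cox_gen t) ^+ k = 1)%g <-> (cox_m s t %| k)%N;
  cox_surj : forall w : W, exists u : seq S, (\prod_(s <- u) cox_gen s)%g = w;
  cox_presentation : forall u v : seq S,
    (\prod_(s <- u) cox_gen s = \prod_(s <- v) cox_gen s)%g
      <-> coxeter_eq cox_m u v
}.

Section CoxeterSystem.
Variables (W : groupType) (S : choiceType) (C : coxeterSystem W S).

Definition cox_eval (u : seq S) : W := (\prod_(s <- u) C s)%g.

Lemma cox_length_ex (w : W) :
  exists n, `[< exists2 u : seq S, cox_eval u = w & size u = n >].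
Proof.
by have [u uw] := cox_surj C w; exists (size u); apply/asboolP; exists u.
Qed.

Definition cox_length (w : W) : nat := ex_minn (cox_length_ex w).

Definition reduced_expression (u : seq S) (w : W) : bool :=
  (cox_eval u == w) && (size u == cox_length w).

Inductive generated_subgroup (A : W -> Prop) : W -> Prop :=
| GenIn x : A x -> generated_subgroup A x
| GenOne : generated_subgroup A 1%g
| GenMul x y : generated_subgroup A x -> generated_subgroup A y ->
    generated_subgroup A (x * y)%g
| GenInv x : generated_subgroup A x -> generated_subgroup A (x^-1)%g.

Definition rank2_subgroup (s t : S) : W -> Prop :=
  generated_subgroup (fun x => x = C s \/ x = C t).

Definition longest_element (H : W -> Prop) (w0 : W) : Prop :=
  H w0 /\ forall x, H x -> (cox_length x <= cox_length w0)%N.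

End CoxeterSystem.

(** * The geometric representation *)

Section GeometricRepresentation.
Variables (R : realType) (S : choiceType) (m : S -> S -> nat).

(* The dual space h^* is [{malg R[S]}], the free R-module on [S]. *)
Definition simple_root (s : S) : {malg R[S]} := << s >>.

(* For m_st = infinity, i.e. [m s t = 0], the argument [pi / 0] is [0]. *)
Definition cox_form (l n : {malg R[S]}) : R :=
  \sum_(s <- msupp l) \sum_(t <- msupp n)
     l@_s * n@_t * - cos (pi / (m s t)%:R).

Definition coroot_pairing (l : {malg R[S]}) (s : S) : R :=
  2%:R * cox_form l (simple_root s)
    / cox_form (simple_root s) (simple_root s).

Definition simple_reflection (s : S) (l : {malg R[S]}) : {malg R[S]} :=
  l - coroot_pairing l s *: simple_root s.

End GeometricRepresentation.

(** * The nil Hecke algebra *)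

Section NilHecke.
Variables (R : realType) (S : choiceType) (m : S -> S -> nat).

(* The algebra is the quotient of the algebra terms over the generators by the
   least congruence containing the axioms of unital associative R-algebras,
   the linear structure of h^* and the defining relations. *)
Inductive nh_term : Type :=
| NhVec of {malg R[S]}
| NhD of S
| NhZero
| NhOne
| NhOpp of nh_term
| NhAdd of nh_term & nh_term
| NhMul of nh_term & nh_term
| NhScale of R & nh_term.

Definition nh_word (u : seq S) : nh_term :=
  foldr (fun s x => NhMul (NhD s) x) NhOne u.

Inductive nh_eq : nh_term -> nh_term -> Prop :=
| NhEqRefl x : nh_eq x x
| NhEqSym x y : nh_eq x y -> nh_eq y x
| NhEqTrans x y z : nh_eq x y -> nh_eq y z -> nh_eq x z
| NhEqOpp x x' : nh_eq x x' -> nh_eq (NhOpp x) (NhOpp x')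
| NhEqAdd x x' y y' : nh_eq x x' -> nh_eq y y' ->
    nh_eq (NhAdd x y) (NhAdd x' y')
| NhEqMul x x' y y' : nh_eq x x' -> nh_eq y y' ->
    nh_eq (NhMul x y) (NhMul x' y')
| NhEqScale a x x' : nh_eq x x' -> nh_eq (NhScale a x) (NhScale a x')
(* algebra axioms *)
| NhAddA x y z : nh_eq (NhAdd x (NhAdd y z)) (NhAdd (NhAdd x y) z)
| NhAddC x y : nh_eq (NhAdd x y) (NhAdd y x)
| NhAdd0 x : nh_eq (NhAdd NhZero x) x
| NhAddN x : nh_eq (NhAdd (NhOpp x) x) NhZero
| NhMulA x y z : nh_eq (NhMul x (NhMul y z)) (NhMul (NhMul x y) z)
| NhMul1l x : nh_eq (NhMul NhOne x) x
| NhMul1r x : nh_eq (NhMul x NhOne) x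
| NhMulDl x y z : nh_eq (NhMul (NhAdd x y) z) (NhAdd (NhMul x z) (NhMul y z))
| NhMulDr x y z : nh_eq (NhMul x (NhAdd y z)) (NhAdd (NhMul x y) (NhMul x z))
| NhScaleA a b x : nh_eq (NhScale a (NhScale b x)) (NhScale (a * b) x)
| NhScale1 x : nh_eq (NhScale 1 x) x
| NhScaleDr a x y :
    nh_eq (NhScale a (NhAdd x y)) (NhAdd (NhScale a x) (NhScale a y))
| NhScaleDl a b x :
    nh_eq (NhScale (a + b) x) (NhAdd (NhScale a x) (NhScale b x))
| NhScaleAl a x y : nh_eq (NhScale a (NhMul x y)) (NhMul (NhScale a x) y)
| NhScaleAr a x y : nh_eq (NhScale a (NhMul x y)) (NhMul x (NhScale a y))
(* linearity of h^* -> nH *)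
| NhVecD l n : nh_eq (NhVec (l + n)) (NhAdd (NhVec l) (NhVec n))
| NhVecZ a l : nh_eq (NhVec (a *: l)) (NhScale a (NhVec l))
(* defining relations *)
| NhVecC l n : nh_eq (NhMul (NhVec l) (NhVec n)) (NhMul (NhVec n) (NhVec l))
| NhLeibniz s l :
    nh_eq (NhMul (NhD s) (NhVec l))
          (NhAdd (NhMul (NhVec (simple_reflection m s l)) (NhD s))
                 (NhScale (coroot_pairing m l s) NhOne))
| NhNil s : nh_eq (NhMul (NhD s) (NhD s)) NhZero
| NhBraid s t : s != t -> (0 < m s t)%N ->
    nh_eq (nh_word (alt_word s t (m s t)))
          (nh_word (alt_word t s (m s t))).

HB.instance Definition _ := gen_eqMixin nh_term.
HB.instance Definition _ := gen_choiceMixin nh_term.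

Let nh_eqb : rel nh_term := fun x y => `[< nh_eq x y >].

Lemma nh_eqb_equiv : equiv_class_of nh_eqb.
Proof.
split=> [x|x y|y x z].
- exact/asboolP/NhEqRefl.
- by apply/asboolP/asboolP; exact: NhEqSym.
- by move=> /asboolP xy /asboolP yz; apply/asboolP; exact: NhEqTrans xy yz.
Qed.

Canonical nh_equiv := EquivRelPack nh_eqb_equiv.

Definition nilHecke := {eq_quot nh_equiv}.

HB.instance Definition _ := Choice.on nilHecke.
HB.instance Definition _ := Quotient.on nilHecke.
HB.instance Definition _ : EqQuotient _ nh_equiv nilHecke :=
  EqQuotient.on nilHecke.

Definition nh_class (x : nh_term) : nilHecke := \pi_nilHecke x.

Lemma nh_classP x y : nh_class x = nh_class y <-> nh_eq x y.
Proof.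
by split=> [/eqquotP/asboolP|xy] //; apply/eqquotP/asboolP.
Qed.

Lemma nh_repr x : nh_eq (repr (nh_class x)) x.
Proof. by apply/nh_classP; rewrite /nh_class reprK. Qed.

Definition nh_opp (x : nilHecke) : nilHecke := nh_class (NhOpp (repr x)).
Definition nh_add (x y : nilHecke) : nilHecke :=
  nh_class (NhAdd (repr x) (repr y)).
Definition nh_mul (x y : nilHecke) : nilHecke :=
  nh_class (NhMul (repr x) (repr y)).
Definition nh_scale (a : R) (x : nilHecke) : nilHecke :=
  nh_class (NhScale a (repr x)).

Lemma nh_oppE x : nh_opp (nh_class x) = nh_class (NhOpp x).
Proof. exact/nh_classP/NhEqOpp/nh_repr. Qed.

Lemma nh_addE x y : nh_add (nh_class x) (nh_class y) = nh_class (NhAdd x y).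
Proof. by apply/nh_classP/NhEqAdd; exact: nh_repr. Qed.

Lemma nh_mulE x y : nh_mul (nh_class x) (nh_class y) = nh_class (NhMul x y).
Proof. by apply/nh_classP/NhEqMul; exact: nh_repr. Qed.

Lemma nh_scaleE a x : nh_scale a (nh_class x) = nh_class (NhScale a x).
Proof. exact/nh_classP/NhEqScale/nh_repr. Qed.

Let nh_E := (nh_oppE, nh_addE, nh_mulE, nh_scaleE).

Lemma nh_ind (P : nilHecke -> Prop) :
  (forall x, P (nh_class x)) -> forall x, P x.
Proof. by move=> Px x; rewrite -[x]reprK. Qed.

Lemma nh_addA : associative nh_add.
Proof.
elim/nh_ind=> x; elim/nh_ind=> y; elim/nh_ind=> z.
by rewrite !nh_E; apply/nh_classP/NhAddA.
Qed.

Lemma nh_addC : commutative nh_add.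
Proof.
by elim/nh_ind=> x; elim/nh_ind=> y; rewrite !nh_E; apply/nh_classP/NhAddC.
Qed.

Lemma nh_add0 : left_id (nh_class NhZero) nh_add.
Proof. by elim/nh_ind=> x; rewrite !nh_E; apply/nh_classP/NhAdd0. Qed.

Lemma nh_addN : left_inverse (nh_class NhZero) nh_opp nh_add.
Proof. by elim/nh_ind=> x; rewrite !nh_E; apply/nh_classP/NhAddN. Qed.

HB.instance Definition _ :=
  GRing.isZmodule.Build nilHecke nh_addA nh_addC nh_add0 nh_addN.

Lemma nh_mulA : associative nh_mul.
Proof.
elim/nh_ind=> x; elim/nh_ind=> y; elim/nh_ind=> z.
by rewrite !nh_E; apply/nh_classP/NhMulA.
Qed.

Lemma nh_mul1l : left_id (nh_class NhOne) nh_mul.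
Proof. by elim/nh_ind=> x; rewrite !nh_E; apply/nh_classP/NhMul1l. Qed.

Lemma nh_mul1r : right_id (nh_class NhOne) nh_mul.
Proof. by elim/nh_ind=> x; rewrite !nh_E; apply/nh_classP/NhMul1r. Qed.

Lemma nh_mulDl : left_distributive nh_mul +%R.
Proof.
elim/nh_ind=> x; elim/nh_ind=> y; elim/nh_ind=> z; rewrite /GRing.add /=.
by rewrite !nh_E; apply/nh_classP/NhMulDl.
Qed.

Lemma nh_mulDr : right_distributive nh_mul +%R.
Proof.
elim/nh_ind=> x; elim/nh_ind=> y; elim/nh_ind=> z; rewrite /GRing.add /=.
by rewrite !nh_E; apply/nh_classP/NhMulDr.
Qed.

(* [pzRingType] does not assert 1 != 0, which is not needed here; it is the
   reason why [nilHecke] is not declared as an [algType], which does. *)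
HB.instance Definition _ := GRing.Zmodule_isPzRing.Build nilHecke
  nh_mulA nh_mul1l nh_mul1r nh_mulDl nh_mulDr.

Lemma nh_scaleA a b x : nh_scale a (nh_scale b x) = nh_scale (a * b) x.
Proof. by elim/nh_ind: x => x; rewrite !nh_E; apply/nh_classP/NhScaleA. Qed.

Lemma nh_scale1 : left_id 1 nh_scale.
Proof. by elim/nh_ind=> x; rewrite !nh_E; apply/nh_classP/NhScale1. Qed.

Lemma nh_scaleDr : right_distributive nh_scale +%R.
Proof.
move=> a; elim/nh_ind=> x; elim/nh_ind=> y; rewrite /GRing.add /=.
by rewrite !nh_E; apply/nh_classP/NhScaleDr.
Qed.

Lemma nh_scaleDl x : {morph nh_scale^~ x : a b / a + b}.
Proof.
elim/nh_ind: x => x a b; rewrite [in RHS]/GRing.add /=.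
by rewrite !nh_E; apply/nh_classP/NhScaleDl.
Qed.

HB.instance Definition _ := GRing.Zmodule_isLmodule.Build R nilHecke
  nh_scaleA nh_scale1 nh_scaleDr nh_scaleDl.

Lemma nh_scaleAl (a : R) (x y : nilHecke) : a *: (x * y) = (a *: x) * y.
Proof.
elim/nh_ind: x => x; elim/nh_ind: y => y; rewrite /GRing.scale /GRing.mul /=.
by rewrite !nh_E; apply/nh_classP/NhScaleAl.
Qed.

Lemma nh_scaleAr (a : R) (x y : nilHecke) : a *: (x * y) = x * (a *: y).
Proof.
elim/nh_ind: x => x; elim/nh_ind: y => y; rewrite /GRing.scale /GRing.mul /=.
by rewrite !nh_E; apply/nh_classP/NhScaleAr.
Qed.

Definition nh_vec (l : {malg R[S]}) : nilHecke := nh_class (NhVec l).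

Definition nh_d (s : S) : nilHecke := nh_class (NhD s).

Definition nh_refl (s : S) : nilHecke :=
  1 - nh_vec (simple_root R s) * nh_d s.

(* An embedded subexpression of [e] is a mask [chi] of the same length, and
   [mask chi e] is the sequence of the letters that are kept. *)
Definition mix (chi : seq bool) (e : seq S) : nilHecke :=
  \prod_(p <- zip chi e) (if p.1 then nh_refl p.2 else nh_d p.2).

End NilHecke.

(* Main.v *)
Require Import Defs.
From HB Require Import structures.
From mathcomp Require Import all_boot all_order all_algebra.
From mathcomp Require Import boolp reals trigo.
From mathcomp Require Import ring zify.
From mathcomp Require Import finmap monalg.
Set Implicit Arguments.
Unset Strict Implicit.
Unset Printing Implicit Defensive.

Import GRing.Theory Num.Theory.
Local Open Scope ring_scope.

(**
The mixed monomials are the coefficients of the iterated twisted Leibniz rule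
  d_e(f g) = sum_chi mix_chi(f) d_{mask chi e}(g)
for Demazure operators on R = Sym(span(al_s, al_t)).  For e = sts... and
e = tst... the left-hand sides agree by the braid relation.  Non-reduced words
act by zero and the d_w, for w in the dihedral group, are linearly independent
over R, because d_{w_o} does not vanish; hence the coefficients of each d_w with
w <> w_o agree as operators on R.  Expanding these coefficients as sums of
f d_u by the defining relations alone, the same independence shows that the two
expansions have equal coefficients, so that the identity holds in the nil Hecke
algebra as well; no basis of the latter is needed.

The braid relation on R is proved with the harmonics Re z^k and Im z^k, where z
is a complex coordinate on the plane: words of length m kill them for k < m,
both alternating words send Im z^m to the same nonzero constant, and
R is spanned by the harmonics over the invariants |z|^2 and Re z^m.
*)

(** * Alternating words and masks *)

Lemma alt_wordS (T : Type) (s t : T) k :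
  alt_word s t k.+1 = s :: alt_word t s k.
Proof.
rewrite /alt_word /mkseq /= -[1%N]addn0 iotaDl -map_comp; congr cons.
by apply: eq_map => i /=; case: odd.
Qed.

Lemma alt_word_rcons (T : Type) (s t : T) k :
  alt_word s t k.+1 = rcons (alt_word s t k) (if odd k then t else s).
Proof. by rewrite /alt_word mkseqS. Qed.

Lemma size_alt_word (T : Type) (s t : T) k : size (alt_word s t k) = k.
Proof. exact: size_mkseq. Qed.

(** Letters are booleans, so that [~~] swaps them and parities compute last letters; later [st] maps
    them to [s] and [t]. *)
Definition alt (b : bool) (k : nat) : seq bool := alt_word b (~~ b) k.

Lemma altS b k : alt b k.+1 = b :: alt (~~ b) k.
Proof. by rewrite /alt alt_wordS negbK. Qed.

Lemma size_alt b k : size (alt b k) = k.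
Proof. exact: size_alt_word. Qed.

Lemma alt_rcons b k : alt b k.+1 = rcons (alt b k) (b (+) odd k).
Proof. by rewrite /alt alt_word_rcons; case: odd; case: b. Qed.

Lemma alt_cat b j k : alt b (j + k) = alt b j ++ alt (b (+) odd j) k.
Proof.
elim: j k => [|j IH] k; first by rewrite addbF.
by rewrite addSnnS IH [alt b j.+1]alt_rcons cat_rcons altS oddS addbN.
Qed.

Fixpoint masks (n : nat) : seq bitseq :=
  if n is n'.+1 then map (cons true) (masks n') ++ map (cons false) (masks n')
  else [:: [::]].

Lemma mem_masks n chi : (chi \in masks n) = (size chi == n).
Proof.
elim: n chi => [|n IH] [|c chi] //=; rewrite mem_cat.
  by apply/norP; split; apply/mapP => -[].
have consE c' : (c :: chi \in map (cons c') (masks n))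
              = (c == c') && (size chi == n).
  apply/mapP/andP => [[chi' chi'n [-> ->]]|[/eqP -> chin]].
    by rewrite eqxx -IH.
  by exists chi; rewrite ?IH.
by rewrite !consE eqSS; case: (c); rewrite ?orbF.
Qed.

Lemma masks_uniq n : uniq (masks n).
Proof.
elim: n => //= n IH; rewrite cat_uniq !map_inj_uniq ?IH => [|x y []|x y []] //.
by rewrite andbT; apply/hasPn => _ /mapP[chi _ ->]; apply/mapP => -[].
Qed.

Lemma big_tuple_masks (V : nmodType) n (p : pred bitseq) (F : bitseq -> V) :
  \sum_(chi : n.-tuple bool | p chi) F chi = \sum_(chi <- masks n | p chi) F
    chi.
Proof.
rewrite -[LHS](big_map (@tval n bool) p F); apply: perm_big.
apply: uniq_perm; rewrite ?masks_uniq // ?map_inj_uniq ?index_enum_uniq //.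
  exact: val_inj.
move=> chi; rewrite mem_masks; apply/mapP/idP => [[c _ ->]|chin].
  by rewrite size_tuple.
by exists (Tuple chin); rewrite ?mem_index_enum.
Qed.

(** * Modules over dihedral Demazure operators *)

Section DemazureModule.
Variables (P : comNzRingType) (al : bool -> P) (dl : bool -> P -> P) (m : nat).
Hypothesis m_gt0 : (0 < m)%N.

(** Common ground of polynomials acting on themselves and of the nil Hecke algebra under left
    multiplication; [f - al b * dl b f] is the reflection of [f]. *)
Record demazure_module (M : zmodType) (act : P -> M -> M)
    (d : bool -> M -> M) : Prop := DemazureModule {
  dm_actDl : forall f g x, act (f + g) x = act f x + act g x;
  dm_actDr : forall f x y, act f (x + y) = act f x + act f y;
  dm_act1 : forall x, act 1 x = x;
  dm_actM : forall b f x, act (al b * f) x = act (al b) (act f x);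
  dm_dD : forall b x y, d b (x + y) = d b x + d b y;
  dm_leibniz : forall b f x,
    d b (act f x) = act (f - al b * dl b f) (d b x) + act (dl b f) x;
  dm_nil : forall b x, d b (d b x) = 0;
  dm_braid : forall x, foldr d x (alt false m) = foldr d x (alt true m)
}.

(* The normal form, as a sum of terms [f * d_u], of the product of the
   reflections (letters [(true, b)]) and Demazure operators (letters
   [(false, b)]) of [w]; it does not depend on the module acted upon. *)
Fixpoint expand (w : seq (bool * bool)) : seq (P * seq bool) :=
  if w is (c, b) :: w' then
    let L := [seq (p.1 - al b * dl b p.1, p.2) | p <- expand w'] in
    if c then L ++ [seq (- (al b * p.1), b :: p.2) | p <- L]
    else [seq (p.1, b :: p.2) | p <- L]
           ++ [seq (dl b p.1, p.2) | p <- expand w']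
  else [:: (1, [::])].

Lemma size_expand w : all (fun p => size p.2 <= size w)%N (expand w).
Proof.
elim: w => [|[c b] w IH] //=.
have IHS : all (fun p => size p.2 <= (size w).+1)%N (expand w).
  by apply: sub_all IH => p /leqW.
by case: c; rewrite all_cat !all_map; apply/andP; split; move: IH IHS.
Qed.

Definition coef (L : seq (P * seq bool)) (v : seq bool) : P :=
  \sum_(p <- L | p.2 == v) p.1.

(** [undup] merges the two empty words; the two words of length [m] stay separate although they act
    equally. *)
Definition alts : seq (seq bool) :=
  undup [seq alt b k | b <- [:: false; true], k <- iota 0 m.+1].

Lemma mem_alts v : reflect (exists2 b, v = alt b (size v) & (size v <= m)%N)
                           (v \in alts).
Proof.
rewrite mem_undup; apply: (iffP allpairsP) => [[[b k] [_]]|[b vE lev]].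
  by rewrite mem_iota => /andP[_ km] ->; exists b; rewrite size_alt.
by exists (b, size v); split; rewrite // ?mem_iota //=; case: (b).
Qed.

Section Module.
Variables (M : zmodType) (act : P -> M -> M) (d : bool -> M -> M).
Hypothesis H : demazure_module act d.

Lemma dm_act0l x : act 0 x = 0.
Proof. by apply: (addrI (act 0 x)); rewrite -(dm_actDl H) !addr0. Qed.

Lemma dm_act0r f : act f 0 = 0.
Proof. by apply: (addrI (act f 0)); rewrite -(dm_actDr H) !addr0. Qed.

Lemma dm_d0 b : d b 0 = 0.
Proof. by apply: (addrI (d b 0)); rewrite -(dm_dD H) !addr0. Qed.

Lemma dm_actNl f x : act (- f) x = - act f x.
Proof. by apply: (addrI (act f x)); rewrite -(dm_actDl H) !subrr dm_act0l. Qed.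

Lemma dm_act_sum I (r : seq I) (p : pred I) F x :
  act (\sum_(i <- r | p i) F i) x = \sum_(i <- r | p i) act (F i) x.
Proof.
by apply: (big_morph (act^~ x)) => [f g|]; rewrite ?dm_act0l ?(dm_actDl H).
Qed.

Lemma dm_dsum b I (r : seq I) F :
  d b (\sum_(i <- r) F i) = \sum_(i <- r) d b (F i).
Proof.
by apply: (big_morph (d b)) => [f g|]; rewrite ?dm_d0 ?(dm_dD H).
Qed.

Lemma dm_act_sumr f I (r : seq I) F :
  act f (\sum_(i <- r) F i) = \sum_(i <- r) act f (F i).
Proof.
by apply: (big_morph (act f)) => [x y|]; rewrite ?dm_act0r ?(dm_actDr H).
Qed.

Definition mixop (w : seq (bool * bool)) (x : M) : M :=
  foldr (fun cb y => if cb.1 then y - act (al cb.2) (d cb.2 y) else d cb.2 y)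
        x w.

Definition comb (L : seq (P * seq bool)) (x : M) : M :=
  \sum_(p <- L) act p.1 (foldr d x p.2).

(** Polynomials move left by d_b f = s_b(f) d_b + dl_b(f) and s_b f = s_b(f) s_b, where s_b = 1 -
    al_b d_b. *)
Lemma comb_expand w x : comb (expand w) x = mixop w x.
Proof.
rewrite /comb; elim: w => [|[c b] w IH] /=;
  first by rewrite big_seq1 (dm_act1 H).
rewrite -IH; case: c; rewrite big_cat !big_map /=; last first.
  rewrite dm_dsum -big_split; apply: eq_bigr => p _.
  by rewrite /= (dm_leibniz H).
rewrite dm_dsum dm_act_sumr -sumrB -big_split; apply: eq_bigr => p _ /=.
rewrite (dm_leibniz H) (dm_actDr H) -!(dm_actM H) dm_actNl.
by rewrite (dm_actDl H p.1) dm_actNl opprD [- _ + _]addrC addrA.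
Qed.

Lemma dm_foldr0 u : foldr d 0 u = 0.
Proof. by elim: u => //= b u ->; exact: dm_d0. Qed.

(** A word that does not alternate repeats a letter, and squares vanish. *)
Lemma foldr_alt_or0 u :
  (exists b, u = alt b (size u)) \/ forall x, foldr d x u = 0.
Proof.
elim: u => [|b u [[b' uE]|u0]]; first by left; exists true.
- have [bb'|/negbTE bb'] := eqVneq b' b; last first.
    left; exists b; rewrite /= altS {1}uE; congr (_ :: alt _ _).
    by move: bb'; case: (b) (b') => [] [].
  rewrite {}bb' in uE; case: u uE => [|c u] uE; first by left; exists b.
  by right => x; move: uE; rewrite /= altS => -[-> _]; exact: (dm_nil H).
- by right => x /=; rewrite u0 dm_d0.
Qed.

Lemma foldr_alt_m b b' x : foldr d x (alt b m) = foldr d x (alt b' m).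
Proof. by case: b b' => [] [] //; rewrite (dm_braid H). Qed.

Lemma foldr_long u x : (m < size u)%N -> foldr d x u = 0.
Proof.
have [[b ->]|u0 _] := foldr_alt_or0 u; last exact: u0.
rewrite size_alt => /subnKC <-; rewrite alt_cat foldr_cat altS /=.
(* The braid relation makes the [m] letters after the initial [b] start with [b] too, so a square
   appears. *)
rewrite (foldr_alt_m _ b); case: (m) m_gt0 => // k _.
by rewrite altS (dm_nil H).
Qed.

Lemma comb_alts L x : all (fun p => size p.2 <= m)%N L ->
  comb L x = \sum_(v <- alts) act (coef L v) (foldr d x v).
Proof.
move=> leL; rewrite /coef.
under eq_bigr => v _ do rewrite dm_act_sum.
rewrite (exchange_big_dep predT) //= /comb big_seq [RHS]big_seq.
apply: eq_bigr => p pL; have [p2A|p2A] := boolP (p.2 \in alts).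
  rewrite (eq_bigl (pred1 p.2)) => [|v]; last by rewrite /= eq_sym.
  by rewrite -big_filter filter_pred1_uniq ?undup_uniq // big_seq1.
rewrite big_seq_cond big1 => [|v /andP[vA /eqP pv]]; last first.
  by rewrite pv vA in p2A.
have [[b pE]|->] := foldr_alt_or0 p.2; last exact: dm_act0r.
by case/mem_alts: p2A; exists b; rewrite // (allP leL).
Qed.

End Module.

End DemazureModule.

(** * Linear independence of the Demazure operators and transfer to other modules *)

Section Faithful.
Variables (P : idomainType) (al : bool -> P) (dl : bool -> P -> P) (m : nat).
Hypotheses (m_gt0 : (0 < m)%N) (HP : demazure_module al dl m *%R dl).
Variable g0 : P.
Hypothesis g0_neq0 : foldr dl g0 (alt false m) != 0.

Let top b : foldr dl g0 (alt b m) = foldr dl g0 (alt false m).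
Proof. exact: foldr_alt_m HP _ _ _. Qed.

Section Comb0.
Variable L : seq (P * seq bool).
Hypotheses (leL : all (fun p => size p.2 <= m)%N L)
  (L0 : forall g, comb *%R dl L g = 0).

(* The test functions are [dl]-images of [g0]: completing an alternating word
   to one of length [m] detects its coefficient, since words of length
   greater than [m] act by zero. *)
Lemma coef_eq0 v : v \in alts m -> (size v < m)%N -> coef L v = 0.
Proof.
have [n] := ubnP (size v); elim: n v => // n IH v; rewrite ltnS => vn vA vm.
have [b vE _] := mem_alts m v vA; set k := size v in vn vm vE.
have := L0 (foldr dl g0 (alt (b (+) odd k) (m - k))).
rewrite (comb_alts HP) // (bigD1_seq v) ?undup_uniq //= [X in _ + X]big1_seq.
  have vcat : v ++ alt (b (+) odd k) (m - k) = alt b m.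
    by rewrite vE -alt_cat subnKC // ltnW.
  rewrite addr0 -foldr_cat vcat top.
  by move/eqP; rewrite mulf_eq0 (negbTE g0_neq0) orbF => /eqP.
move=> v' /andP[v'v v'A]; have [b' v'E v'm] := mem_alts m v' v'A.
have [v'k|kv'|v'k] := ltngtP (size v') k.
- by rewrite IH ?mul0r //; [exact: leq_trans vn | exact: ltn_trans vm].
- rewrite -foldr_cat (foldr_long m_gt0 HP) ?mulr0 // size_cat size_alt.
  by rewrite -{1}(subnKC (ltnW vm)) ltn_add2r.
(* The other word of this length ends in the letter that starts the completion, so a square
   appears. *)
rewrite v'k in v'E; case: k => [|k] in vn vm vE v'E v'k *.
  by rewrite vE v'E in v'v.
rewrite v'E alt_rcons foldr_rcons.
have -> : b' = ~~ b.
  have [b'b|] := eqVneq b' b; last by case: (b) (b') => [] [].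
  by rewrite vE v'E b'b eqxx in v'v.
by rewrite -(subnSK vm) altS /= addNb addbN (dm_nil HP) (dm_foldr0 HP) mulr0.
Qed.

(** The two words of length [m] are one operator, so only the sum of their coefficients can be
    detected; evaluation at [g0] does so. *)
Lemma coef_top_eq0 : \sum_(v <- alts m | size v == m) coef L v = 0.
Proof.
apply/eqP; rewrite -(mulIr_eq0 _ (mulIf g0_neq0)) mulr_suml; apply/eqP.
rewrite -[RHS](L0 g0) (comb_alts HP) // [RHS](bigID (fun v => size v == m)) /=.
rewrite [X in _ + X]big_seq_cond [X in _ + X]big1 => [|v /andP[vA vm]];
  last first.
  have [b _ lev] := mem_alts m v vA.
  by rewrite coef_eq0 ?mul0r // ltn_neqAle vm.
rewrite addr0 big_seq_cond [RHS]big_seq_cond;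
  apply: eq_bigr => v /andP[/mem_alts[b vE _] /eqP vm].
by rewrite vE vm top.
Qed.

(** Lower coefficients vanish, and the top ones cancel because the braid relation also holds on
    [M]. *)
Lemma comb_eq0 (M : zmodType) act d (x : M) :
  demazure_module al dl m act d -> comb act d L x = 0.
Proof.
move=> H; rewrite (comb_alts H) // (bigID (fun v => size v == m)) /=.
rewrite [X in _ + X]big_seq_cond [X in _ + X]big1 => [|v /andP[vA vm]];
  last first.
  have [b _ lev] := mem_alts m v vA.
  by rewrite coef_eq0 ?(dm_act0l H) // ltn_neqAle vm.
rewrite addr0 -[RHS](dm_act0l H (foldr d x (alt false m))) -coef_top_eq0.
rewrite (dm_act_sum H) big_seq_cond [RHS]big_seq_cond.
apply: eq_bigr => v /andP[/mem_alts[b vE _] /eqP vm].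
by rewrite vE vm (foldr_alt_m H b false).
Qed.

End Comb0.

(** Each letter either differentiates [f] and is left out, or reflects [f] and passes on to [g]. *)
Lemma leibniz_masks e f g : foldr dl (f * g) e =
  \sum_(chi <- masks (size e))
     mixop al *%R dl (zip chi e) f * foldr dl g (mask chi e).
Proof.
elim: e f g => [|b e IH] f g /=; first by rewrite big_seq1.
rewrite IH (dm_dsum HP) big_cat !big_map /= -big_split /=.
by apply: eq_bigr => chi _; rewrite (dm_leibniz HP).
Qed.

(** For fixed [f], the braid relation on [f * g] equates two Leibniz expansions for all [g];
    independence then compares coefficients. *)
Lemma mixop_coef_eq b k f : (k < m)%N ->
  \sum_(chi <- masks m | mask chi (alt false m) == alt b k)
     mixop al *%R dl (zip chi (alt false m)) f
  = \sum_(chi <- masks m | mask chi (alt true m) == alt b k)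
     mixop al *%R dl (zip chi (alt true m)) f.
Proof.
move=> km; pose term c chi :=
  (mixop al *%R dl (zip chi (alt c m)) f, mask chi (alt c m)).
pose L := [seq term false chi | chi <- masks m]
       ++ [seq (- (term true chi).1, (term true chi).2) | chi <- masks m].
have leL : all (fun p => size p.2 <= m)%N L.
  have size_mask_masks c chi : chi \in masks m ->
    (size (mask chi (alt c m)) <= m)%N.
    by rewrite mem_masks => /eqP sz;
      rewrite size_mask ?size_alt // -sz count_size.
  by rewrite all_cat !all_map; apply/andP; split; apply/allP => chi chiM;
    exact: size_mask_masks.
have := @coef_eq0 L leL _ (alt b k);
  rewrite size_alt /coef big_cat !big_map sumrN.
move=> L0; apply/eqP; rewrite -subr_eq0 L0 //; last first.
  by apply/mem_alts; exists b; rewrite size_alt // ltnW.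
move=> g; rewrite /comb big_cat !big_map /=.
under [X in _ + X]eq_bigr => chi _ do rewrite mulNr.
rewrite sumrN; have := leibniz_masks (alt true m) f g.
by have := leibniz_masks (alt false m) f g;
  rewrite !size_alt (dm_braid HP) => -> ->; rewrite subrr.
Qed.

(** The normal forms of both sides are formal lists over [P]; their difference acts by zero on [P]
    by [mixop_coef_eq], hence on [M] by [comb_eq0]. *)
Lemma mixop_eq (M : zmodType) act d (x : M) b k :
  demazure_module al dl m act d -> (k < m)%N ->
  \sum_(chi <- masks m | mask chi (alt false m) == alt b k)
     mixop al act d (zip chi (alt false m)) x
  = \sum_(chi <- masks m | mask chi (alt true m) == alt b k)
     mixop al act d (zip chi (alt true m)) x.
Proof.
move=> H km.
pose Lc c := flatten [seq expand al dl (zip chi (alt c m))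
                     | chi <- masks m & mask chi (alt c m) == alt b k].
pose L := Lc false ++ [seq (- p.1, p.2) | p <- Lc true].
have combLc (N : zmodType) (actN : P -> N -> N) dN y c :
    demazure_module al dl m actN dN ->
    comb actN dN (Lc c) y
    = \sum_(chi <- masks m | mask chi (alt c m) == alt b k)
        mixop al actN dN (zip chi (alt c m)) y.
  move=> HN; rewrite /comb big_flatten big_map big_filter.
  by apply: eq_bigr => chi _; rewrite -(comb_expand HN).
have combL (N : zmodType) (actN : P -> N -> N) dN y :
    demazure_module al dl m actN dN ->
    comb actN dN L y = comb actN dN (Lc false) y - comb actN dN (Lc true) y.
  move=> HN; rewrite /comb big_cat big_map /=.
  by under [X in _ + X]eq_bigr => p _ do rewrite (dm_actNl HN); rewrite sumrN.
have leLc c : all (fun p => size p.2 <= m)%N (Lc c).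
  apply/allP => p /flattenP[_ /mapP[chi + ->] pL].
  rewrite mem_filter mem_masks => /andP[_ /eqP sz].
  apply: leq_trans (allP (size_expand _ _ _) _ pL) _.
  by rewrite size_zip sz size_alt minnn.
apply/eqP; rewrite -subr_eq0 -!combLc // -combL // comb_eq0 //.
  by rewrite all_cat all_map leLc; apply: leLc.
by move=> g; rewrite combL // !combLc // mixop_coef_eq ?subrr.
Qed.

End Faithful.

(** * The braid relation for Demazure operators *)

Section DihedralBraid.
Variables (R : realType) (P : idomainType) (cst : {rmorphism R -> P}).
Variables (al : bool -> P) (dl : bool -> P -> P) (m : nat).
Hypothesis m_gt1 : (1 < m)%N.

Let angle : R := pi / m%:R.
Let angleM (k : nat) : R := k%:R * angle.

Definition cartan (b b' : bool) : R :=
  if b == b' then 2%:R else - (2%:R * cos angle).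

Hypothesis P_ind : forall Q : P -> Prop,
  (forall a, Q (cst a)) -> (forall f g, Q f -> Q g -> Q (f + g)) ->
  (forall b f, Q f -> Q (al b * f)) -> forall f, Q f.
Hypothesis dlD : forall b f g, dl b (f + g) = dl b f + dl b g.
Hypothesis dlM : forall b f g,
  dl b (f * g) = (f - al b * dl b f) * dl b g + dl b f * g.
Hypothesis dl_cst : forall b a, dl b (cst a) = 0.
Hypothesis dl_al : forall b b', dl b (al b') = cst (cartan b b').

Lemma dl0 b : dl b 0 = 0.
Proof. by rewrite -(rmorph0 cst) dl_cst rmorph0. Qed.

Lemma dlN b f : dl b (- f) = - dl b f.
Proof. by apply: (addrI (dl b f)); rewrite -dlD !subrr dl0. Qed.

Lemma dlB b f g : dl b (f - g) = dl b f - dl b g.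
Proof. by rewrite dlD dlN. Qed.

Lemma dl_inv b i f : dl b i = 0 -> dl b (i * f) = i * dl b f.
Proof. by move=> i0; rewrite dlM i0 mulr0 subr0 mul0r addr0. Qed.

Lemma dl_al_diag b : dl b (al b) = 2%:R.
Proof. by rewrite dl_al /cartan eqxx rmorph_nat. Qed.

Lemma dl_dl b f : dl b (dl b f) = 0.
Proof.
elim/P_ind: f => [a|f g IHf IHg|b' f IH]; first by rewrite dl_cst dl0.
  by rewrite !dlD IHf IHg addr0.
rewrite dlM dl_al dlD [dl b (_ * dl b f)]dlM IH mulr0 add0r dlB dl_al.
rewrite [al b * _]mulrC !(dl_inv _ (dl_cst _ _)) dl_al_diag; ring.
Qed.

Let c : P := cst (cos angle).
Let s : P := cst (sin angle).
Let sV : P := cst (sin angle)^-1.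

Lemma dl_al_flip b : dl b (al (~~ b)) = - (2%:R * c).
Proof.
by rewrite dl_al /cartan; case: b => /=; rewrite rmorphN rmorphM /= rmorph_nat.
Qed.

Lemma angleMS k : angleM k.+1 = angleM k + angle.
Proof. by rewrite /angleM -natr1 mulrDl mul1r. Qed.

Lemma sin_angleM_gt0 k : (0 < k < m)%N -> 0 < sin (angleM k).
Proof.
move=> /andP[k0 km]; have m0 : (0 : R) < m%:R by rewrite ltr0n ltnW.
apply: sin_gt0_pi; rewrite /angleM /angle mulr_gt0 ?ltr0n ?divr_gt0 ?pi_gt0 //=.
by rewrite mulrCA gtr_pMr ?pi_gt0 // ltr_pdivrMr // mul1r ltr_nat.
Qed.

Lemma angleMm : angleM m = pi.
Proof. by rewrite /angleM /angle mulrC divfK // pnatr_eq0 -lt0n ltnW. Qed.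

Lemma s_sV : s * sV = 1.
Proof.
rewrite /s /sV -rmorphM divff ?rmorph1 // lt0r_neq0 //.
by have := @sin_angleM_gt0 1; rewrite /angleM mul1r; apply.
Qed.

Lemma c_c : c * c = 1 - s * s.
Proof.
rewrite -!rmorphM -[1](rmorph1 cst) -rmorphB -!expr2 /=.
by rewrite -(cos2Dsin2 angle) addrK.
Qed.

(* Orthonormal coordinates such that [al b] is the second one; with
   z_b = absc b + i al b one has z_(~~ b) = exp(i pi/m) * conj z_b. *)
Definition absc b := sV * (al (~~ b) + c * al b).

Fixpoint harm (b : bool) (k : nat) : P * P :=
  if k is k'.+1 then
    let h := harm b k' in
    (absc b * h.1 - al b * h.2, absc b * h.2 + al b * h.1)
  else (1, 0).

(* The real and imaginary parts of z_b ^ k. *)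
Definition harm_re b k := (harm b k).1.
Definition harm_im b k := (harm b k).2.
Definition norm2 b := absc b * absc b + al b * al b.

Lemma harm_reS b k : harm_re b k.+1 = absc b * harm_re b k - al b * harm_im b k.
Proof. by []. Qed.
Lemma harm_imS b k : harm_im b k.+1 = absc b * harm_im b k + al b * harm_re b k.
Proof. by []. Qed.

Lemma absc_flip b : absc (~~ b) = c * absc b + s * al b.
Proof. rewrite /absc negbK; ring: c_c s_sV. Qed.

Lemma al_flip b : al (~~ b) = s * absc b - c * al b.
Proof. rewrite /absc mulrA s_sV; ring. Qed.

Lemma norm2_flip b : norm2 (~~ b) = norm2 b.
Proof. rewrite /norm2 absc_flip {1 2}al_flip; ring: c_c. Qed.

(** These are the parts of the k-th power of z_(~~ b) = exp(i pi/m) conj z_b. *)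
Lemma harm_flip b k :
  harm_re (~~ b) k = cst (cos (angleM k)) * harm_re b k
    + cst (sin (angleM k)) * harm_im b k
  /\ harm_im (~~ b) k = cst (sin (angleM k)) * harm_re b k
    - cst (cos (angleM k)) * harm_im b k.
Proof.
elim: k => [|k [IHC IHS]].
  by rewrite /angleM mul0r cos0 sin0 rmorph1 rmorph0 /harm_re /harm_im /=
    !(mulr0, mul0r, mulr1, addr0, subr0).
rewrite !harm_reS !harm_imS IHC IHS angleMS cosD sinD.
rewrite !(rmorphD, rmorphB, rmorphM) /=.
rewrite absc_flip al_flip -/c -/s; split; ring.
Qed.

Lemma dl_absc b : dl b (absc b) = 0.
Proof.
rewrite dl_inv ?dl_cst // dlD dl_inv ?dl_cst // dl_al_diag dl_al_flip; ring.
Qed.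

(** The reflection in [al b] conjugates z_b, so it fixes real parts of powers and negates imaginary
    ones. *)
Lemma dl_harm b k :
  dl b (harm_re b k) = 0 /\ al b * dl b (harm_im b k) = 2%:R * harm_im b k.
Proof.
elim: k => [|k [IHC IHS]].
  by rewrite /harm_re /harm_im /= dl0 !mulr0 -(rmorph1 cst) dl_cst.
rewrite harm_reS harm_imS dlB dlD !(dl_inv _ (dl_absc b)) !dlM IHC dl_al_diag.
split; ring: IHS.
Qed.

Lemma dl_harm_re b k : dl b (harm_re b k) = 0.
Proof. by have [] := dl_harm b k. Qed.

Lemma dl_harm_im1 b : dl b (harm_im b 1) = 2%:R.
Proof. by rewrite harm_imS mulr0 add0r mulr1 dl_al_diag. Qed.

(** This is [dl b] applied to Im z^(k+2) = 2 al_b Re z^(k+1) + |z|^2 Im z^k, where Re z^(k+1) and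
    |z|^2 are invariant. *)
Lemma dl_harm_imSS b k :
  dl b (harm_im b k.+2) = 4%:R * harm_re b k.+1 + norm2 b * dl b (harm_im b k).
Proof.
have [_ E] := dl_harm b k.
rewrite harm_imS dlD !(dl_inv _ (dl_absc b)) dlM dl_harm_re dl_al_diag.
rewrite harm_imS dlD !(dl_inv _ (dl_absc b)) dlM dl_harm_re dl_al_diag.
rewrite harm_reS /norm2; ring: E.
Qed.

Lemma dl_norm2 b b' : dl b (norm2 b') = 0.
Proof.
have -> : norm2 b' = norm2 b.
  by have [->//|] := eqVneq b' b; case: b b' => [] [] // _;
    rewrite -[in RHS]norm2_flip.
rewrite dlD dl_inv ?dl_absc // mulr0 add0r dlM dl_al_diag; ring.
Qed.

(** * Words annihilating or detecting the harmonics *)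

Fixpoint killed (n : nat) (f : P) : Prop :=
  if n is n'.+1 then forall b, killed n' (dl b f) else f = 0.

Lemma killed0 n : killed n 0.
Proof. by elim: n => //= n IH b; rewrite dl0. Qed.

Lemma killedD n f g : killed n f -> killed n g -> killed n (f + g).
Proof.
elim: n f g => [f g -> ->|n IH f g kf kg b] /=; first exact: addr0.
by rewrite dlD; apply: IH.
Qed.

Lemma killedM n i f : (forall b, dl b i = 0) -> killed n f -> killed n (i * f).
Proof.
move=> i0; elim: n f => [f ->|n IH f kf b] /=; first exact: mulr0.
by rewrite dl_inv //; apply: IH.
Qed.

Lemma killedS n f : killed n f -> killed n.+1 f.
Proof.
elim: n f => [f -> b|n IH f kf b]; first by rewrite dl0.
exact/IH/kf.
Qed.

Lemma killed_foldr f u : killed (size u) f -> foldr dl f u = 0.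
Proof.
elim/last_ind: u f => [//|u b IH] f; rewrite size_rcons foldr_rcons => kf.
exact: IH.
Qed.

Lemma dl_harm_re_flip b k :
  dl (~~ b) (harm_re b k) = cst (sin (angleM k)) * dl (~~ b) (harm_im (~~ b) k).
Proof.
have [E _] := harm_flip (~~ b) k; move: E; rewrite negbK => ->.
by rewrite dlD !dl_inv ?dl_cst // dl_harm_re mulr0 add0r.
Qed.

Lemma dl_harm_im_flip b k :
  dl (~~ b) (harm_im b k) = - (cst (cos (angleM k)) * dl (~~ b) (harm_im (~~ b)
    k)).
Proof.
have [_ E] := harm_flip (~~ b) k; move: E; rewrite negbK => ->.
by rewrite dlB !dl_inv ?dl_cst // dl_harm_re mulr0 add0r.
Qed.

(** By [harm_flip], each letter sends both parts of z^k to constant multiples of the derivative of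
    Im z^k in that letter's own coordinate. *)
Lemma killed_harm_of_dl k : (forall b, killed k (dl b (harm_im b k))) ->
  forall b, killed k.+1 (harm_re b k) /\ killed k.+1 (harm_im b k).
Proof.
move=> kS b.
have eq_or_flip b' : b' = b \/ b' = ~~ b by case: b b' => [] []; auto.
split=> b' /=; have [->|->] := eq_or_flip b'.
- by rewrite dl_harm_re; exact: killed0.
- by rewrite dl_harm_re_flip; apply: killedM => // b''; exact: dl_cst.
- exact: kS.
- rewrite dl_harm_im_flip -mulNr -rmorphN.
  by apply: killedM => // b''; exact: dl_cst.
Qed.

Lemma killed_dl_harm_im k b : killed k (dl b (harm_im b k)).
Proof.
have [n] := ubnP k; elim: n k b => // n IH [|[|k]] b; rewrite ltnS => kn.
- exact: dl0.
- by move=> b' /=; rewrite dl_harm_im1 -(rmorph_nat cst) dl_cst.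
- rewrite dl_harm_imSS; apply: killedD.
    apply: killedM => [b'|]; first by rewrite -(rmorph_nat cst) dl_cst.
    by have [] := killed_harm_of_dl (fun b' => IH k.+1 b' kn) b.
  apply: killedM => [b'|]; first exact: dl_norm2.
  by do 2!apply: killedS; apply: IH; exact: ltnW.
Qed.

Lemma killed_harm b k : killed k.+1 (harm_re b k) /\ killed k.+1 (harm_im b k).
Proof. by apply: killed_harm_of_dl => b'; exact: killed_dl_harm_im. Qed.

Lemma foldr_dlD f g u : foldr dl (f + g) u = foldr dl f u + foldr dl g u.
Proof. by elim: u => //= b u ->; rewrite dlD. Qed.

Lemma foldr_dl_inv i f u : (forall b, dl b i = 0) ->
  foldr dl (i * f) u = i * foldr dl f u.
Proof. by move=> i0; elim: u => //= b u ->; rewrite dl_inv. Qed.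

Lemma foldr_dl_harm_im b k u : size u = k.+1 ->
  foldr dl (dl b (harm_im b k.+2)) u = 4%:R * foldr dl (harm_re b k.+1) u.
Proof.
move=> uk; rewrite dl_harm_imSS foldr_dlD !foldr_dl_inv => [|b'|b']; last first.
- by rewrite -(rmorph_nat cst) dl_cst.
- exact: dl_norm2.
rewrite [X in norm2 b * X]killed_foldr ?mulr0 ?addr0 // uk.
exact/killedS/killed_dl_harm_im.
Qed.

(** For k > 0 this is 2 * 4^(k-1) times the product of sin(j pi/m) over 1 <= j <= k. *)
Fixpoint top_value (k : nat) : R :=
  if k is k'.+1 then
    sin (angleM k) * ((if k' is 0 then 2 else 4)%:R * top_value k')
  else 1.

Lemma top_value_gt0 k : (k < m)%N -> 0 < top_value k.
Proof.
elim: k => [|k IH] km; first exact: ltr01.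
rewrite mulr_gt0 ?sin_angleM_gt0 // mulr_gt0 ?IH ?(ltnW km) //.
by rewrite ltr0n; case: (k).
Qed.

(** The last letter acts first. On Re z^k in the opposite coordinate it gives a sine times the
    derivative of an imaginary part, which leads to Re z^(k-1), again opposite to the next
    letter. *)
Lemma foldr_alt_harm_re a k :
  foldr dl (harm_re (a (+) odd k) k) (alt a k) = cst (top_value k).
Proof.
elim: k => [|k IH]; first by rewrite /= rmorph1.
have := dl_harm_re_flip (~~ (a (+) odd k)) k.+1; rewrite negbK => E.
rewrite alt_rcons foldr_rcons oddS addbN {}E.
rewrite foldr_dl_inv => [|b]; last exact: dl_cst.
rewrite [top_value k.+1]/= rmorphM; congr (_ * _).
case: k IH => [|k] IH; first by rewrite /= dl_harm_im1 mulr1 rmorph_nat.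
by rewrite foldr_dl_harm_im ?size_alt // IH rmorphM rmorph_nat.
Qed.

(** Since exp(i pi) = -1, z_(~~ b)^m = - conj z_b^m. *)
Lemma harm_im_m b : harm_im (~~ b) m = harm_im b m.
Proof.
have [_ ->] := harm_flip b m.
by rewrite angleMm sinpi cospi rmorph0 rmorphN1 mul0r sub0r mulN1r opprK.
Qed.

Lemma dl_harm_re_m b b' : dl b' (harm_re b m) = 0.
Proof.
have [->|/negbTE bb'] := eqVneq b' b; first exact: dl_harm_re.
have {bb'} -> : b' = ~~ b by case: b b' bb' => [] [].
by rewrite dl_harm_re_flip angleMm sinpi rmorph0 mul0r.
Qed.

Lemma foldr_alt_harm_im a b :
  foldr dl (harm_im b m) (alt a m) = cst (4%:R * top_value m.-1).
Proof.
case: m m_gt1 (@harm_im_m) => [|[|k]] // _ Sm.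
(* The imaginary part may be taken in the coordinate of the letter that acts first. *)
have {b}-> : harm_im b k.+2 = harm_im (a (+) odd k.+1) k.+2.
  have [->//|/negbTE bb'] := eqVneq b (a (+) odd k.+1).
  by rewrite -Sm; congr harm_im; case: b (a (+) _) bb' => [] [].
rewrite alt_rcons foldr_rcons foldr_dl_harm_im ?size_alt // foldr_alt_harm_re.
by rewrite rmorphM rmorph_nat.
Qed.

Lemma foldr_alt_harm_im_neq0 a b :
  injective cst -> foldr dl (harm_im b m) (alt a m) != 0.
Proof.
move=> cst_inj; rewrite foldr_alt_harm_im -(rmorph0 cst) (inj_eq cst_inj).
by rewrite mulf_neq0 ?pnatr_eq0 // lt0r_neq0 // top_value_gt0 // prednK // ltnW.
Qed.

(** * The braid relation on all polynomials *)

Definition braided (f : P) : Prop :=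
  foldr dl f (alt false m) = foldr dl f (alt true m).

Lemma braidedD f g : braided f -> braided g -> braided (f + g).
Proof. by rewrite /braided !foldr_dlD => -> ->. Qed.

Lemma braidedM i f : (forall b, dl b i = 0) -> braided f -> braided (i * f).
Proof. by move=> i0; rewrite /braided !foldr_dl_inv // => ->. Qed.

Lemma braidedB f g : braided f -> braided g -> braided (f - g).
Proof.
move=> bf bg; apply: braidedD => //; rewrite -mulN1r.
by apply: braidedM => // b; rewrite -(rmorphN1 cst) dl_cst.
Qed.

Lemma killed_leq n k f : (n <= k)%N -> killed n f -> killed k f.
Proof.
by move=> /subnKC <-; elim: (k - n)%N => [|j IH] kf; rewrite ?addn0 // addnS;
  apply/killedS/IH.
Qed.

Lemma harm_add b j k :
  harm_re b (j + k) = harm_re b j * harm_re b k - harm_im b j * harm_im b k /\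
  harm_im b (j + k) = harm_im b j * harm_re b k + harm_re b j * harm_im b k.
Proof.
elim: j => [|j [IHC IHS]].
  by rewrite /= mul1r mul0r subr0 /harm_re /harm_im /= mul0r mul1r add0r.
by rewrite addSn !harm_reS !harm_imS IHC IHS; split; ring.
Qed.

Lemma harm_norm b k :
  harm_re b k * harm_re b k + harm_im b k * harm_im b k = norm2 b ^+ k.
Proof.
elim: k => [|k IH]; first by rewrite /harm_re /harm_im /= mulr0 addr0 mulr1.
by rewrite harm_reS harm_imS exprS -IH /norm2; ring.
Qed.

Lemma dl_norm2X b b' k : dl b (norm2 b' ^+ k) = 0.
Proof.
elim: k => [|k IH]; first by rewrite expr0 -(rmorph1 cst) dl_cst.
by rewrite exprS dl_inv ?dl_norm2 // IH mulr0.
Qed.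

Lemma dl_nat b k : dl b k%:R = 0.
Proof. by rewrite -(rmorph_nat cst) dl_cst. Qed.

(* For k > m the harmonics are reduced to smaller ones by
   z^(m+j) = 2 Re(z^m) z^j - |z|^(2j) conj(z^(m-j)), j <= m, and
   z^(2m+i) = 2 Re(z^m) z^(m+i) - |z|^(2m) z^i. *)
Lemma braided_harm b k : braided (harm_re b k) /\ braided (harm_im b k).
Proof.
have [n] := ubnP k; elim: n k => // n IH k; rewrite ltnS => kn.
have [km|mk|->] := ltngtP k m.
- have [kC kS] := killed_harm b k.
  by split; rewrite /braided !killed_foldr // size_alt;
    apply: killed_leq kC || apply: killed_leq kS.
- have inv i f : (forall b', dl b' i = 0) -> braided f ->
      braided (2%:R * (i * f)).
    by move=> i0 bf; apply: braidedM => [b'|]; [exact: dl_nat|exact: braidedM].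
  have dlCm b' : dl b' (harm_re b m) = 0 by exact: dl_harm_re_m.
  have dlr b' j : dl b' (norm2 b ^+ j) = 0 by exact: dl_norm2X.
  have [k2m|k2m] := leqP k (m + m).
  + pose j := (k - m)%N; pose i := (m - j)%N.
    have [jm im kE mE] :
        [/\ (j < k)%N, (i < k)%N, (k = m + j)%N & (m = i + j)%N].
      by rewrite /i /j; split; lia.
    have [[Cj Sj] [Ci Si]] := (IH j (leq_trans jm kn), IH i (leq_trans im kn)).
    have [CA SA] := harm_add b m j; have [CB SB] := harm_add b i j.
    have N := harm_norm b j; rewrite -mE in CB SB.
    have -> : harm_re b k = 2%:R * (harm_re b m * harm_re b j)
      - norm2 b ^+ j * harm_re b i.
      by rewrite kE CA -N CB SB; ring.
    have -> : harm_im b k = 2%:R * (harm_re b m * harm_im b j)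
      + norm2 b ^+ j * harm_im b i.
      by rewrite kE SA -N CB SB; ring.
    by split; [apply: braidedB|apply: braidedD];
      solve [exact: inv | exact: braidedM].
  + pose j := (k - m)%N; pose i := (j - m)%N.
    have [jm im kE mE] :
        [/\ (j < k)%N, (i < k)%N, (k = j + m)%N & (j = i + m)%N].
      by rewrite /i /j; split; lia.
    have [[Cj Sj] [Ci Si]] := (IH j (leq_trans jm kn), IH i (leq_trans im kn)).
    have [CA SA] := harm_add b j m; have [CB SB] := harm_add b i m.
    have N := harm_norm b m; rewrite -mE in CB SB.
    have -> : harm_re b k = 2%:R * (harm_re b m * harm_re b j)
      - norm2 b ^+ m * harm_re b i.
      by rewrite kE CA -N CB SB; ring.
    have -> : harm_im b k = 2%:R * (harm_re b m * harm_im b j)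
      - norm2 b ^+ m * harm_im b i.
      by rewrite kE SA -N CB SB; ring.
    by split; apply: braidedB; solve [exact: inv | exact: braidedM].
- split; last by rewrite /braided !foldr_alt_harm_im.
  have alt_m a : alt a m = rcons (alt a m.-1) (a (+) odd m.-1).
    by rewrite -alt_rcons prednK // ltnW.
  by rewrite /braided !alt_m !foldr_rcons !dl_harm_re_m !killed_foldr //;
    exact: killed0.
Qed.

(** Carrying a harmonic factor closes the induction on [f]: a root times a harmonic is a combination
    of harmonics over invariants, and k = 0 gives back [f]. *)
Lemma braided_mul_harm f b k :
  braided (f * harm_re b k) /\ braided (f * harm_im b k).
Proof.
elim/P_ind: f b k => [a|f g IHf IHg|b' f IH] b k.
- by have [? ?] := braided_harm b k; split; apply: braidedM.
- have [? ?] := IHf b k; have [? ?] := IHg b k.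
  by split; rewrite mulrDl; apply: braidedD.
pose half := cst (2%:R)^-1.
have halfE : half * 2%:R = 1.
  by rewrite -(rmorph_nat cst) -rmorphM mulVf ?rmorph1 // pnatr_eq0.
have dlhalf b'' : dl b'' half = 0 by exact: dl_cst.
(* By [harm_flip] the harmonics may be written in the coordinate of the root being multiplied. *)
wlog {b'}-> : b' b / b' = b.
  move=> wl; have [->|/negbTE bb'] := eqVneq b' b; first exact: wl.
  have {bb'} -> : b = ~~ b' by case: b b' bb' => [] [].
  have [bC bS] := wl b' b' erefl; have [-> ->] := harm_flip b' k.
  rewrite !(mulrBr, mulrDr) ![_ * (cst _ * _)]mulrCA.
  by split; [apply: braidedD|apply: braidedB]; apply: braidedM.
case: k => [|k].
  have [bC bS] := IH b 1%N; move: bS;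
    rewrite /harm_im /harm_re /= mulr0 add0r !mulr1 mulrC => bS.
  by split; rewrite ?mulr0 /braided // !killed_foldr //; exact: killed0.
have [C0 S0] := IH b k; have [C2 S2] := IH b k.+2.
(* Real and imaginary parts of z^(k+2) - |z|^2 z^k = 2i al_b z^(k+1). *)
have -> : al b * f * harm_re b k.+1 =
    half * (f * harm_im b k.+2 - norm2 b * (f * harm_im b k)).
  rewrite !(harm_imS, harm_reS) /norm2 -[LHS]mul1r -halfE; ring.
have -> : al b * f * harm_im b k.+1 =
    half * (norm2 b * (f * harm_re b k) - f * harm_re b k.+2).
  rewrite !(harm_imS, harm_reS) /norm2 -[LHS]mul1r -halfE; ring.
by split; apply: braidedM => //; apply: braidedB => //;
  apply: braidedM => // b''; exact: dl_norm2.
Qed.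

Lemma demazure_module_self : demazure_module al dl m *%R dl.
Proof.
split=> //; try by [move=> *; rewrite ?mulrDl ?mulrDr ?mul1r ?mulrA].
- exact: dl_dl.
- by move=> f; have [] := braided_mul_harm f false 0; rewrite mulr1.
Qed.

End DihedralBraid.

(** * Demazure operators on polynomials in two simple roots *)

Section RankTwoPolynomials.
Variables (R : realType) (m : nat).
Hypothesis m_gt1 : (1 < m)%N.

Notation P := {poly {poly R}}.

Definition const2 : {rmorphism R -> P} := polyC \o polyC.
Definition root2 (b : bool) : P := if b then 'X else 'X%:P.

Lemma const2_inj : injective const2.
Proof. by move=> a b /polyC_inj/polyC_inj. Qed.

Lemma poly2_ind (Q : P -> Prop) : (forall a, Q (const2 a)) ->
  (forall f g, Q f -> Q g -> Q (f + g)) ->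
  (forall b f, Q f -> Q (root2 b * f)) -> forall f, Q f.
Proof.
move=> Qcst QD QM; elim/poly_ind => [|f p Qf]; first exact: (Qcst 0).
apply: (QD); first by rewrite mulrC; exact: (QM true).
elim/poly_ind: p => [|p a Qp]; first exact: (Qcst 0).
rewrite polyCD; apply: (QD); last exact: Qcst.
by rewrite polyCM mulrC; exact: (QM false).
Qed.

Let sgal b b' : P := root2 b' - const2 (cartan R m b b') * root2 b.

Let sg1_comm b : commr_rmorph const2 (sgal b false).
Proof. by move=> a; exact: mulrC. Qed.

Let sg1 b : {rmorphism {poly R} -> P} := horner_morph (@sg1_comm b).

Let sg_comm b : commr_rmorph (sg1 b) (sgal b true).
Proof. by move=> p; exact: mulrC. Qed.

Let sg b : {rmorphism P -> P} := horner_morph (@sg_comm b).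

Let sg_cst b a : sg b (const2 a) = const2 a.
Proof. exact: etrans (horner_morphC _ _) (horner_morphC _ _). Qed.

Let sg_al b b' : sg b (root2 b') = sgal b b'.
Proof.
case: b'; first exact: horner_morphX.
exact: etrans (horner_morphC _ _) (horner_morphX _).
Qed.

Let dl_ex b f : exists q, f - sg b f = root2 b * q.
Proof.
elim/poly2_ind: f => [a|f g [p fE] [q gE]|b' f [q fE]].
- by exists 0; rewrite sg_cst subrr mulr0.
- by exists (p + q); rewrite rmorphD /= opprD addrACA fE gE mulrDr.
(* From al' f - s(al') s(f) = al' (f - s(f)) + (al' - s(al')) s(f). *)
exists (root2 b' * q + const2 (cartan R m b b') * sg b f).
rewrite rmorphM /= sg_al {1}(_ : f = sg b f + root2 b * q);
  last by rewrite -fE addrC subrK.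
by rewrite /sgal; ring.
Qed.

(** The quotient is unique because roots cancel in a domain; identities for it are checked after
    multiplication by the root. *)
Definition demazure b f : P := projT1 (cid (dl_ex b f)).

Lemma demazureE b f : root2 b * demazure b f = f - sg b f.
Proof. by rewrite /demazure; case: cid. Qed.

Lemma root2_neq0 b : root2 b != 0.
Proof. by case: b; rewrite /= ?polyC_eq0 polyX_eq0. Qed.

Lemma demazureD b f g : demazure b (f + g) = demazure b f + demazure b g.
Proof.
by apply: (mulfI (root2_neq0 b)); rewrite mulrDr !demazureE rmorphD /=; ring.
Qed.

Lemma demazureM b f g :
  demazure b (f * g) = (f - root2 b * demazure b f) * demazure b g
    + demazure b f * g.
Proof.
apply: (mulfI (root2_neq0 b)).
by rewrite mulrDr mulrCA [X in _ + X]mulrA !demazureE rmorphM /=; ring.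
Qed.

Lemma demazure_const b a : demazure b (const2 a) = 0.
Proof.
by apply: (mulfI (root2_neq0 b)); rewrite demazureE sg_cst subrr mulr0.
Qed.

Lemma demazure_root b b' : demazure b (root2 b') = const2 (cartan R m b b').
Proof.
by apply: (mulfI (root2_neq0 b));
  rewrite demazureE sg_al /sgal opprB addrC subrK mulrC.
Qed.

Lemma demazure_module_poly : demazure_module root2 demazure m *%R demazure.
Proof.
exact: (demazure_module_self m_gt1 poly2_ind demazureD demazureM demazure_const
  demazure_root).
Qed.

Lemma poly_top_neq0 : exists g : P, foldr demazure g (alt false m) != 0.
Proof.
(* Im z^m goes to a nonzero constant, a positive multiple of the product of sin(j pi/m) over 0 < j <
   m. *)
exists (harm_im const2 root2 m true m).
exact: (foldr_alt_harm_im_neq0 m_gt1 demazureD demazureM demazure_const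
  demazure_root false true const2_inj).
Qed.

End RankTwoPolynomials.

(** * The dihedral part of the nil Hecke algebra *)

Section PolySum.
Variables (Q : nzRingType) (V : zmodType) (g : nat -> Q -> V).
Hypothesis gD : forall i a b, g i (a + b) = g i a + g i b.

(* Replaces [horner_morph] for the values in [nilHecke], which is only a
   [pzRingType]. *)
Definition poly_sum (p : {poly Q}) : V := \sum_(i < size p) g i p`_i.

Let g0 i : g i 0 = 0.
Proof. by apply: (addrI (g i 0)); rewrite -gD !addr0. Qed.

Lemma poly_sum_leq n (p : {poly Q}) :
  (size p <= n)%N -> poly_sum p = \sum_(i < n) g i p`_i.
Proof.
move=> pn; rewrite /poly_sum (big_ord_widen n (fun i => g i p`_i)) //.
rewrite big_mkcond.
apply: eq_bigr => i _; case: ltnP => // pi.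
by rewrite nth_default.
Qed.

Lemma poly_sumD (p q : {poly Q}) : poly_sum (p + q) = poly_sum p + poly_sum q.
Proof.
pose n := maxn (size p) (size q).
rewrite !(@poly_sum_leq n) ?leq_maxl ?leq_maxr ?(leq_trans (size_polyD _ _)) //.
by rewrite -big_split; apply: eq_bigr => i _; rewrite coefD gD.
Qed.

Lemma poly_sumC a : poly_sum a%:P = g 0 a.
Proof. by rewrite (@poly_sum_leq 1) ?size_polyC_leq1 // big_ord1 coefC. Qed.

Lemma poly_sumX (p : {poly Q}) :
  poly_sum ('X * p) = \sum_(i < size p) g i.+1 p`_i.
Proof.
rewrite (@poly_sum_leq (size p).+1) => [|]; last first.
  by rewrite (leq_trans (size_polyMleq _ _)) // size_polyX.
rewrite big_ord_recl coefXM g0 add0r.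
by apply: eq_bigr => i _; rewrite coefXM.
Qed.

Lemma poly_sumCM a (p : {poly Q}) :
  poly_sum (a%:P * p) = \sum_(i < size p) g i (a * p`_i).
Proof.
rewrite (@poly_sum_leq (size p)) => [|]; last first.
  by rewrite mul_polyC size_scale_leq.
by apply: eq_bigr => i _; rewrite coefCM.
Qed.

End PolySum.

Section NilHeckeModule.
Variables (R : realType) (T : choiceType) (cm : T -> T -> nat).

Notation nH := (nilHecke R cm).
Notation vec := (nh_vec (R := R) cm).
Notation D := (nh_d R cm).

Lemma nh_vecD l n : vec (l + n) = vec l + vec n.
Proof. by rewrite [RHS]nh_addE; apply/nh_classP/NhVecD. Qed.

Lemma nh_vecZ a l : vec (a *: l) = a *: vec l.
Proof. by rewrite [RHS]nh_scaleE; apply/nh_classP/NhVecZ. Qed.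

Lemma nh_vecB l n : vec (l - n) = vec l - vec n.
Proof. by rewrite nh_vecD -scaleN1r nh_vecZ scaleN1r. Qed.

Lemma nh_vecC l n : vec l * vec n = vec n * vec l.
Proof.
by rewrite [LHS]nh_mulE [RHS]nh_mulE; apply/nh_classP/NhVecC.
Qed.

Lemma nh_leibniz s l : D s * vec l =
  vec (simple_reflection cm s l) * D s + coroot_pairing cm l s *: (1 : nH).
Proof.
rewrite [X in _ = _ + X](nh_scaleE cm _ (NhOne R T)).
rewrite [X in _ = X + _]nh_mulE [LHS]nh_mulE [RHS]nh_addE.
exact/nh_classP/NhLeibniz.
Qed.

Lemma nh_nil s : D s * D s = 0.
Proof. by rewrite [LHS]nh_mulE; apply/nh_classP/NhNil. Qed.

Lemma nh_class_word (u : seq T) (x : nH) :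
  nh_class cm (nh_word R u) * x = foldr (fun s y => D s * y) x u.
Proof.
elim: u => [|s u IH] /=; first exact: mul1r.
by rewrite -IH mulrA [D s * _]nh_mulE.
Qed.

Lemma cox_form_root s t :
  cox_form cm (simple_root R s) (simple_root R t) = - cos (pi / (cm s t)%:R).
Proof.
by rewrite /cox_form /simple_root !msuppU oner_eq0 !big_seq_fset1 !mcoeffUU
  !mul1r.
Qed.

End NilHeckeModule.

Section DihedralNilHecke.
Variables (R : realType) (T : choiceType) (cm : T -> T -> nat).
Variables (m : nat) (st : bool -> T).
Hypothesis m_gt1 : (1 < m)%N.
Hypothesis cm_diag : forall s, cm s s = 1%N.
Hypothesis cm_st : forall b, cm (st b) (st (~~ b)) = m.
Hypothesis st_neq : st false != st true.

Notation nH := (nilHecke R cm).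
Notation P := {poly {poly R}}.
Notation root2 := (@root2 R).
Notation demazure := (@demazure R m).

Let A b : nH := nh_vec cm (simple_root R (st b)).
Let D b : nH := nh_d R cm (st b).

Lemma coroot_pairing_st b b' :
  coroot_pairing cm (simple_root R (st b')) (st b) = cartan R m b b'.
Proof.
rewrite /coroot_pairing !cox_form_root cm_diag divr1 cospi opprK divr1 /cartan.
case: eqVneq => [->|bb']; first by rewrite cm_diag divr1 cospi opprK mulr1.
have -> : b = ~~ b' by case: b b' bb' => [] [].
by rewrite cm_st mulrN.
Qed.

Lemma nh_leibniz_st b b' :
  D b * A b' = (A b' - cartan R m b b' *: A b) * D b
                 + cartan R m b b' *: (1 : nH).
Proof. by rewrite nh_leibniz nh_vecB nh_vecZ coroot_pairing_st. Qed.

Let nh_poly1 : {poly R} -> nH := poly_sum (fun i a => a *: A false ^+ i).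
(** Evaluation of polynomials at the commuting elements [A false] and [A true]. *)
Definition nh_poly : P -> nH := poly_sum (fun j p => A true ^+ j * nh_poly1 p).

Let nh_poly1D p q : nh_poly1 (p + q) = nh_poly1 p + nh_poly1 q.
Proof. by apply: poly_sumD => i a b; rewrite scalerDl. Qed.

Lemma nh_polyD f g : nh_poly (f + g) = nh_poly f + nh_poly g.
Proof. by apply: poly_sumD => i p q; rewrite nh_poly1D mulrDr. Qed.

Lemma nh_polyB f g : nh_poly (f - g) = nh_poly f - nh_poly g.
Proof. by apply: (addIr (nh_poly g)); rewrite -nh_polyD !subrK. Qed.

Lemma nh_poly_const a : nh_poly (const2 R a) = a *: (1 : nH).
Proof.
rewrite /nh_poly /const2 /= poly_sumC => [|i p q];
  last by rewrite nh_poly1D mulrDr.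
by rewrite mul1r /nh_poly1 poly_sumC // => i b c; rewrite scalerDl.
Qed.

Lemma nh_poly_constM a f : nh_poly (const2 R a * f) = a *: nh_poly f.
Proof.
rewrite /nh_poly poly_sumCM => [|i p q]; last by rewrite nh_poly1D mulrDr.
rewrite /poly_sum scaler_sumr; apply: eq_bigr => j _.
rewrite nh_scaleAr /nh_poly1 poly_sumCM => [|i b c]; last by rewrite scalerDl.
rewrite /poly_sum scaler_sumr; congr (_ * _); apply: eq_bigr => i _.
by rewrite scalerA.
Qed.

Lemma nh_poly_root b f : nh_poly (root2 b * f) = A b * nh_poly f.
Proof.
case: b; rewrite /nh_poly.
  rewrite poly_sumX => [|i p q]; last by rewrite nh_poly1D mulrDr.
  by rewrite mulr_sumr; apply: eq_bigr => j _; rewrite exprS mulrA.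
rewrite poly_sumCM => [|i p q]; last by rewrite nh_poly1D mulrDr.
rewrite mulr_sumr; apply: eq_bigr => j _.
rewrite mulrA (commrX j (nh_vecC _ _ _ : GRing.comm (A false) (A true))) -mulrA.
congr (_ * _); rewrite /nh_poly1 poly_sumX => [|i b c];
  last by rewrite scalerDl.
by rewrite mulr_sumr; apply: eq_bigr => i _; rewrite exprS -nh_scaleAr.
Qed.

Lemma nh_poly_reflection b b' a f :
  nh_poly (root2 b' * f - const2 R a * (root2 b * f))
  = (A b' - a *: A b) * nh_poly f.
Proof. by rewrite nh_polyB nh_poly_constM !nh_poly_root mulrBl -nh_scaleAl. Qed.

(** The defining relation covers a single root; both sides obey the twisted Leibniz rule, so
    induction over root factors extends it. *)
Lemma nh_d_poly b f :
  D b * nh_poly f = nh_poly (f - root2 b * demazure b f) * D b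
    + nh_poly (demazure b f).
Proof.
elim/poly2_ind: f => [a|f g IHf IHg|b' f IH].
- rewrite demazure_const mulr0 subr0 nh_poly_const -nh_scaleAr -nh_scaleAl.
  by rewrite mulr1 mul1r -(rmorph0 (const2 R)) nh_poly_const scale0r addr0.
- rewrite demazureD mulrDr opprD addrACA.
  rewrite (nh_polyD f) (nh_polyD (f - _)) (nh_polyD (demazure b f)).
  by rewrite mulrDr mulrDl IHf IHg addrACA.
set a := cartan R m b b'; have dlE := demazureM m b (root2 b') f.
rewrite demazure_root -/a in dlE.
have -> : root2 b' * f - root2 b * demazure b (root2 b' * f)
  = root2 b' * (f - root2 b * demazure b f) -
    const2 R a * (root2 b * (f - root2 b * demazure b f)).
  by rewrite dlE; ring.
have -> : demazure b (root2 b' * f)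
  = root2 b' * demazure b f - const2 R a * (root2 b * demazure b f)
    + const2 R a * f.
  by rewrite dlE; ring.
rewrite (nh_polyD (_ - _) (const2 R a * f)) !nh_poly_reflection nh_poly_constM
  nh_poly_root mulrA nh_leibniz_st -/a mulrDl -nh_scaleAl.
by rewrite mul1r -!mulrA IH mulrDr addrA.
Qed.

Lemma map_alt b k : [seq st c | c <- alt b k] = alt_word (st b) (st (~~ b)) k.
Proof.
by rewrite /alt /alt_word /mkseq -map_comp; apply: eq_map => i /=; case: odd.
Qed.

Lemma foldr_nh_d u (x : nH) :
  foldr (fun b y => D b * y) x u = nh_class cm (nh_word R (map st u)) * x.
Proof. by rewrite nh_class_word; elim: u => //= b u ->. Qed.

Lemma demazure_module_nh :
  demazure_module root2 demazure m
    (fun f (x : nH) => nh_poly f * x) (fun b x => D b * x).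
Proof.
split=> [f g x|f x y|x|b f x|b x y|b f x|b x|x].
- by rewrite nh_polyD mulrDl.
- exact: mulrDr.
- by rewrite -(rmorph1 (const2 R)) nh_poly_const scale1r mul1r.
- rewrite nh_poly_root mulrA -[root2 b]mulr1 nh_poly_root.
  by rewrite -(rmorph1 (const2 R)) nh_poly_const scale1r mulr1.
- exact: mulrDr.
- by rewrite mulrA nh_d_poly mulrDl mulrA.
- by rewrite mulrA nh_nil mul0r.
rewrite !foldr_nh_d !map_alt /=; congr (_ * x); apply/nh_classP.
by rewrite -(cm_st false); apply: NhBraid => //; rewrite cm_st ltnW.
Qed.

(** Evaluation at 1 turns left multiplications back into elements of the algebra. *)
Lemma mixop_nh chi e :
  mixop root2 (fun f (x : nH) => nh_poly f * x) (fun b x => D b * x)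
    (zip chi e) 1
  = mix R cm chi (map st e).
Proof.
rewrite /mix; elim: chi e => [|c chi IH] [|b e]; rewrite ?big_nil //=.
rewrite big_cons -IH /=; case: c => //=.
rewrite /nh_refl mulrBl mul1r -mulrA -[root2 b]mulr1 nh_poly_root.
by rewrite -(rmorph1 (const2 R)) nh_poly_const scale1r mulr1.
Qed.

Theorem mix_alt_eq b k : (k < m)%N ->
  \sum_(chi : m.-tuple bool |
          mask chi (alt_word (st false) (st true) m)
          == alt_word (st b) (st (~~ b)) k)
     mix R cm chi (alt_word (st false) (st true) m)
  = \sum_(chi : m.-tuple bool |
          mask chi (alt_word (st true) (st false) m)
          == alt_word (st b) (st (~~ b)) k)
     mix R cm chi (alt_word (st true) (st false) m).
Proof.
move=> km; have [g0 g0P] := poly_top_neq0 R m_gt1.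
have := mixop_eq (ltnW m_gt1) (demazure_module_poly R m_gt1) g0P 1 b
                 demazure_module_nh km.
have st_inj : injective st by case=> [] [] // E; move: st_neq; rewrite E eqxx.
have conv c : \sum_(chi <- masks m | mask chi (alt c m) == alt b k)
     mixop root2 (fun f (x : nH) => nh_poly f * x) (fun b x => D b * x)
       (zip chi (alt c m)) 1
   = \sum_(chi : m.-tuple bool | mask chi (alt_word (st c) (st (~~ c)) m)
                              == alt_word (st b) (st (~~ b)) k)
       mix R cm chi (alt_word (st c) (st (~~ c)) m).
  rewrite -big_tuple_masks -!map_alt; apply: eq_big => [chi|chi _].
    by rewrite -map_mask (inj_eq (inj_map st_inj)).
  exact: mixop_nh.
by rewrite !conv.
Qed.

End DihedralNilHecke.

(** * Reduced expressions in a dihedral parabolic subgroup *)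

Section DihedralWords.
Variables (W : groupType) (T : choiceType) (C : coxeterSystem W T).
Variables (st : bool -> T) (m : nat).
Hypothesis m_gt0 : (0 < m)%N.
Hypothesis st_m : cox_m C (st false) (st true) = m.

Local Open Scope group_scope.

Definition eval (u : seq bool) : W := cox_eval C (map st u).

Lemma eval_cons b u : eval (b :: u) = C (st b) * eval u.
Proof. exact: big_cons. Qed.

Lemma eval_cat u v : eval (u ++ v) = eval u * eval v.
Proof. by rewrite /eval /cox_eval map_cat big_cat. Qed.

Lemma gen_square s : C s * C s = 1.
Proof. by rewrite -[LHS]expg1; apply/(cox_m_order C); rewrite cox_m_diag. Qed.

Lemma eval_cons2 b u : eval (b :: b :: u) = eval u.
Proof. by rewrite !eval_cons mulgA gen_square mul1g. Qed.

(** The second word is the reversal of the first: for k > 0, [b (+) ~~ odd k] is the last letter of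
    [alt b k]. *)
Lemma eval_alt_inv b k : eval (alt b k) * eval (alt (b (+) ~~ odd k) k) = 1.
Proof.
elim: k => [|k IH]; first by rewrite /eval /cox_eval /= big_nil mulg1.
rewrite oddS negbK [alt (_ (+) _) _]altS alt_rcons -cats1 -eval_cat -catA /=.
by rewrite eval_cat eval_cons2 -addbN.
Qed.

Lemma eval_altV b k : (eval (alt b k))^-1 = eval (alt (b (+) ~~ odd k) k).
Proof. by rewrite -[LHS]mulg1 -(eval_alt_inv b k) mulKg. Qed.

Lemma eval_alt_pow k :
  eval (alt false (k + k)) = (C (st false) * C (st true)) ^+ k.
Proof.
elim: k => [|k IH]; first by rewrite /eval /cox_eval /= big_nil.
by rewrite addSn addnS !altS !eval_cons mulgA IH expgS.
Qed.

(** (st)^k is an alternating word of length 2k whose second half is the inverse of [alt true k], and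
    st has order [m]. *)
Lemma eval_alt_eq k : eval (alt false k) = eval (alt true k) <-> (m %| k)%N.
Proof.
rewrite -st_m -(cox_m_order C) -eval_alt_pow alt_cat eval_cat addFb.
have := eval_altV true k; rewrite addTb negbK => <-; split=> [->|E].
  exact: mulgV.
by rewrite -[LHS](mulgVK (eval (alt true k))) E mul1g.
Qed.

Lemma eval_alt_m b b' : eval (alt b m) = eval (alt b' m).
Proof.
have E : eval (alt false m) = eval (alt true m) by apply/eval_alt_eq.
by case: b b' => [] [].
Qed.

Lemma eval_shorten u : (exists b, u = alt b (size u)) \/
  exists2 u', (size u' < size u)%N & eval u' = eval u.
Proof.
elim: u => [|b u [[b' uE]|[u' u'u u'E]]]; first by left; exists true.
- have [bb'|bb'] := eqVneq b' b; last first.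
    left; exists b; rewrite /= altS {1}uE; congr (_ :: alt _ _).
    by case: (b) (b') bb' => [] [].
  rewrite {}bb' in uE; case: u uE => [|c u] uE; first by left; exists b.
  right; exists u; first exact: leqnSn.
  by move: uE; rewrite /= altS => -[-> _]; rewrite eval_cons2.
- by right; exists (b :: u') => //; rewrite !eval_cons u'E.
Qed.

Lemma eval_alt_form u :
  exists b k, [/\ (k <= m)%N, (k <= size u)%N & eval u = eval (alt b k)].
Proof.
have [n] := ubnP (size u); elim: n u => // n IH u; rewrite ltnS => un.
have shorter u' : (size u' < size u)%N -> eval u' = eval u ->
    exists b k, [/\ (k <= m)%N, (k <= size u)%N & eval u = eval (alt b k)].
  move=> u'u <-; have [b [k [km ku ->]]] := IH u' (leq_trans u'u un).
  by exists b, k; split=> //; exact: leq_trans ku (ltnW u'u).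
have [[b uE]|[u']] := eval_shorten u; last exact: shorter.
have [um|um] := leqP (size u) m; first by exists b, (size u); rewrite -uE.
(* The word is [b], then [m] letters, then [v]; the braid relation lets those [m] letters start with
   [b], and two letters cancel. *)
pose v := alt (~~ b (+) odd m) (size u - m.+1).
have {}uE : u = b :: alt (~~ b) m ++ v.
  by rewrite {1}uE -{1}(subnKC um) alt_cat altS oddS addbN -addNb.
apply: (shorter (alt (~~ b) m.-1 ++ v)).
  by rewrite uE /= !size_cat !size_alt ltnS leq_add2r leq_pred.
rewrite uE eval_cons !eval_cat (eval_alt_m (~~ b) b) -(prednK m_gt0) altS.
by rewrite !mulgA -eval_cons eval_cons2.
Qed.

Lemma rank2_eval x : rank2_subgroup C (st false) (st true) x ->
  exists u, x = eval u.
Proof.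
elim=> [y [->|->]||y z _ [u ->] _ [v ->]|y _ [u ->]].
- by exists [:: false]; rewrite /eval /cox_eval big_seq1.
- by exists [:: true]; rewrite /eval /cox_eval big_seq1.
- by exists [::]; rewrite /eval /cox_eval big_nil.
- by exists (u ++ v); rewrite eval_cat.
have [b [k [_ _ ->]]] := eval_alt_form u; exists (alt (b (+) ~~ odd k) k).
exact: eval_altV.
Qed.

Lemma cox_length_eval u : (cox_length C (eval u) <= size u)%N.
Proof.
rewrite /cox_length; case: ex_minnP => n _; apply.
by apply/asboolP; exists (map st u); rewrite ?size_map.
Qed.

Lemma reduced_alt u w : reduced_expression C (map st u) w ->
  exists b, u = alt b (cox_length C w).
Proof.
case/andP=> /eqP wE /eqP uw; rewrite size_map in uw.
have [[b uE]|[u' u'u u'E]] := eval_shorten u; first by exists b; rewrite -uw.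
by have := cox_length_eval u'; rewrite u'E /eval wE -uw leqNgt u'u.
Qed.

(** Reduced words alternate, and the two alternating words of one positive length below [m] have
    different values. *)
Lemma reduced_expression_unique w0 w b :
  longest_element C (rank2_subgroup C (st false) (st true)) w0 -> w <> w0 ->
  reduced_expression C (map st (alt b (cox_length C w))) w ->
  (cox_length C w < m)%N /\
  forall u, reduced_expression C (map st u) w = (u == alt b (cox_length C w)).
Proof.
move=> [w0_in w0_max] ww0 wred; have [/eqP wE _] := andP wred.
set l := cox_length C w in wred wE *.
have [v w0E] := rank2_eval w0_in.
have [b0 [k [km _ vE]]] := eval_alt_form v; rewrite vE {v vE} in w0E.
have w_in : rank2_subgroup C (st false) (st true) w.
  rewrite -wE /cox_eval; elim: (alt b l) => [|c u IH] /=.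
    by rewrite big_nil; exact: GenOne.
  by rewrite big_cons; apply: GenMul => //; apply: GenIn; case: c; [right|left].
have lk : (l <= k)%N.
  rewrite -(size_alt b0 k) (leq_trans (w0_max _ w_in)) // w0E.
  exact: cox_length_eval.
have lm : (l < m)%N.
  rewrite ltn_neqAle (leq_trans lk km) andbT; apply/eqP => lm.
  (* At length [m], both [w] and [w0] would be the common value of the two alternating words. *)
  have km' : k = m by apply/eqP; rewrite eqn_leq km -lm.
  by apply: ww0; rewrite w0E km' (eval_alt_m b0 b) -lm; exact: esym.
split=> // u; apply/idP/eqP => [ured|->//].
have [b' uE] := reduced_alt ured; rewrite -/l in uE.
have [<-//|bb'] := eqVneq b' b.
have E : eval (alt false l) = eval (alt true l).
  have [/eqP wE' _] := andP ured; rewrite uE in wE'.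
  by case: b b' bb' wE wE' {wred uE} => [] [] // _ <- E; rewrite ?E.
(* Now [m] divides [l < m], so [l = 0] and both words are empty. *)
have /eval_alt_eq/dvdn_leq ml := E.
by case: l ml lm uE {wred wE lk E} => [|l] ml lm; [|rewrite ltnNge ml in lm].
Qed.

End DihedralWords.

(** * From reduced expressions of [w] to alternating words *)

Theorem theorem4p16 (R : realType) (W : groupType) (S : choiceType)
    (C : coxeterSystem W S) (s t : S) (m : nat)
    (m_st : m = cox_m C s t) (m_finite : (0 < m)%N)
    (w0 : W) (w0_longest : longest_element C (rank2_subgroup C s t) w0)
    (w : W) (w_in : rank2_subgroup C s t w) (w_neq : w <> w0) :
  \sum_(chi : m.-tuple bool |
          reduced_expression C (mask chi (alt_word s t m)) w)
     mix R (cox_m C) chi (alt_word s t m)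
  = \sum_(chi : m.-tuple bool |
          reduced_expression C (mask chi (alt_word t s m)) w)
     mix R (cox_m C) chi (alt_word t s m).
Proof.
have [->//|s_neq_t] := eqVneq s t.
pose st b := if b then t else s.
have m_gt1 : (1 < m)%N.
  by rewrite ltn_neqAle m_finite eq_sym m_st cox_m_neq1.
have st_m b : cox_m C (st b) (st (~~ b)) = m.
  by case: b; rewrite /st m_st // cox_m_sym.
have st_inj : injective st by case=> [] [] //; rewrite /st => E; move: s_neq_t;
  rewrite E eqxx.
have maskE c (chi : bitseq) :
    mask chi (alt_word (st c) (st (~~ c)) m) = map st (mask chi (alt c m)).
  by rewrite map_mask map_alt.
(* If no word in [s] and [t] is a reduced expression of [w], both sums are empty. *)
have [[u ured]|no_red] := pselect (exists u, reduced_expression C (map st u) w);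
  last first.
  rewrite !big1 // => chi.
    by rewrite (maskE true) => ured; case: no_red;
      exists (mask chi (alt true m)).
  by rewrite (maskE false) => ured; case: no_red;
    exists (mask chi (alt false m)).
have [b uE] := reduced_alt ured; rewrite uE in ured.
have [lm redE] := reduced_expression_unique m_finite (st_m false) w0_longest
  w_neq ured.
(* Both index conditions become equality with the single reduced word. *)
have eqv c (chi : bitseq) :
    reduced_expression C (mask chi (alt_word (st c) (st (~~ c)) m)) w
    = (mask chi (alt_word (st c) (st (~~ c)) m)
       == alt_word (st b) (st (~~ b)) (cox_length C w)).
  by rewrite maskE redE -map_alt (inj_eq (inj_map st_inj)).
under eq_bigl do rewrite (eqv false).
under [RHS]eq_bigl do rewrite (eqv true).
exact: (mix_alt_eq R m_gt1 (cox_m_diag C) st_m s_neq_t b lm).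
Qed.
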